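(* Let $p$ be an odd prime, let $A, B$ be integers, and let $\Delta = A^2 + 4B$. If $\Delta$ is a non-zero quadratic residue modulo $p$ (that is, $\Delta \not\equiv 0 \pmod p$ and $\Delta$ is congruent to a square modulo $p$), then $k_{A,B}(p)$ divides $p-1$. In particular, $k_{A,B}(p) \le p-1$.
   Context: For integers $A, B$, let $(E_n)_{n \ge 0}$ be the sequence defined by $E_0 = 0$, $E_1 = 1$ and $E_{n+1} = A E_n + B E_{n-1}$ for $n \ge 1$. For a prime $p$, $k_{A,B}(p)$ denotes the period of the sequence $(E_n)$ modulo $p$, where, as for the Fibonacci sequence (the case $A = B = 1$), the period is the smallest positive index $i$ such that $E_i \equiv 0 \pmod p$ and $E_{i+1} \equiv 1 \pmod p$.
   Formalization: When p divides B the period k_{A,B}(p) does not exist (e.g. p = 3, A = 1, B = 0); the formal theorem proves that it exists when p does not divide B, and that it divides p-1 and is at most p-1 whenever it exists. *)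

(* Defs.v *)
From mathcomp Require Import all_boot all_order all_algebra.

Set Implicit Arguments.
Unset Strict Implicit.
Unset Printing Implicit Defensive.

Import Order.TTheory GRing.Theory Num.Theory.
Local Open Scope ring_scope.

Fixpoint Eseq (A B : int) (n : nat) : int :=
  match n with
  | 0%N => 0
  | n'.+1 => match n' with
             | 0%N => 1
             | n''.+1 => A * Eseq A B n' + B * Eseq A B n''
             end
  end.

Definition return_index (A B : int) (p i : nat) : Prop :=
  [/\ (0 < i)%N,
      (Eseq A B i = 0 %[mod p%:Z])%Z
    & (Eseq A B i.+1 = 1 %[mod p%:Z])%Z].

(* [is_period A B p k] reads "k_{A,B}(p) is defined and equals k".  It is a
   relation because there need not be any return index: if p divides B but
   not A, then E_n = A ^ (n - 1) is nonzero modulo p for every n >= 1. *)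
Definition is_period (A B : int) (p k : nat) : Prop :=
  return_index A B p k /\
  (forall i : nat, return_index A B p i -> (k <= i)%N).

Definition nonzero_quadratic_residue (p : nat) (d : int) : Prop :=
  (d <> 0 %[mod p%:Z])%Z /\ (exists x : int, (d = x ^+ 2 %[mod p%:Z])%Z).

(* Main.v *)
Require Import Defs.
From mathcomp Require Import all_boot all_order all_algebra.
From mathcomp Require Import finfield ring.

Set Implicit Arguments.
Unset Strict Implicit.
Unset Printing Implicit Defensive.

Import Order.TTheory GRing.Theory Num.Theory.
Local Open Scope ring_scope.

(** Modulo [p] the polynomial [X^2 - A X - B] has two distinct roots [x] and
    [y], and Binet's formula [(x - y) E_n = x^n - y^n] shows that [i > 0] is a
    return index iff [x^i = y^i = 1]. By Fermat's little theorem, [p - 1] is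
    such an index as soon as [x] and [y] are nonzero, and the exponents [i]
    with [x^i = y^i = 1] are stable under remainders, so the least positive one
    divides [p - 1]. *)

Lemma eqz_modp_Fp (p : nat) (m n : int) : prime p ->
  (m = n %[mod p%:Z])%Z <-> m%:~R = n%:~R :> 'F_p.
Proof.
move=> p_pr.
have E : (m == n %[mod p%:Z])%Z = (m%:~R == n%:~R :> 'F_p).
  by rewrite eqz_mod_dvd (dvdz_pcharf (pchar_Fp p_pr)) rmorphB subr_eq0.
by split=> /eqP H; apply/eqP; rewrite ?E // -E.
Qed.

(** Both sides satisfy the recurrence with characteristic roots [x] and [y] and agree at 0 and 1;
    the induction carries two consecutive indices. Keeping the factor [x - y] on the left avoids
    division. *)
Lemma Eseq_binet (R : comNzRingType) (A B : int) (x y : R) (n : nat) :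
  x + y = A%:~R -> x * y = - B%:~R ->
  (x - y) * (Eseq A B n)%:~R = x ^+ n - y ^+ n.
Proof.
move=> sxy pxy; suff [] : (x - y) * (Eseq A B n)%:~R = x ^+ n - y ^+ n /\
  (x - y) * (Eseq A B n.+1)%:~R = x ^+ n.+1 - y ^+ n.+1 by [].
elim: n => [|n [IHn IHn1]]; first by rewrite /= !expr0 !expr1; split; ring.
split=> //; rewrite -[Eseq A B n.+2]/(A * Eseq A B n.+1 + B * Eseq A B n).
rewrite rmorphD !rmorphM /= -sxy.
have -> : B%:~R = - (x * y) :> R by rewrite pxy opprK.
have -> : (x - y) * ((x + y) * (Eseq A B n.+1)%:~R
    + - (x * y) * (Eseq A B n)%:~R) =
  (x + y) * ((x - y) * (Eseq A B n.+1)%:~R)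
    - x * y * ((x - y) * (Eseq A B n)%:~R) by ring.
by rewrite IHn IHn1 !exprS; ring.
Qed.

(** By Binet, [E_i = 0] gives [x^i = y^i]; then [E_{i+1} = 1] reads [x - y = (x - y) x^i], and
    [x - y] cancels. *)
Lemma return_index_roots (p i : nat) (A B : int) (x y : 'F_p) : prime p ->
  x + y = A%:~R -> x * y = - B%:~R -> x != y ->
  return_index A B p i <-> [/\ (0 < i)%N, x ^+ i = 1 & y ^+ i = 1].
Proof.
move=> p_pr sxy pxy; rewrite -subr_eq0 => dxy.
have binet n := Eseq_binet n sxy pxy.
split=> [[i0 /(eqz_modp_Fp _ _ p_pr) E0 /(eqz_modp_Fp _ _ p_pr) E1]|].
  have /subr0_eq xyi : x ^+ i - y ^+ i = 0 by rewrite -binet E0 mulr0.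
  have xi : x ^+ i = 1.
    apply: (mulfI dxy); rewrite mulr1; have := binet i.+1.
    by rewrite E1 mulr1 !exprS -xyi -mulrBl.
  by split; rewrite -?xyi.
case=> i0 xi yi; split=> //; apply/(eqz_modp_Fp _ _ p_pr); apply: (mulfI dxy).
  by rewrite binet xi yi mulr0 subrr.
by rewrite binet !exprS xi yi !mulr1.
Qed.

(** The quadratic formula, with [z] a square root of the discriminant: oddness of [p] makes 2
    invertible, and the roots differ by [z], which is nonzero. *)
Lemma Fp_roots (p : nat) (A B : int) : prime p -> odd p ->
  nonzero_quadratic_residue p (A ^+ 2 + 4 * B) ->
  exists x y : 'F_p, [/\ x + y = A%:~R, x * y = - B%:~R & x != y].
Proof.
move=> p_pr p_odd [D0 [z /(eqz_modp_Fp _ _ p_pr)]].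
rewrite rmorphD rmorphM !rmorphXn /= => Dz.
have two0 : 2 != 0 :> 'F_p.
  rewrite -(dvdn_pcharf (pchar_Fp p_pr)) dvdn_prime2 //.
  by apply: contraTneq p_odd => ->.
have z0 : z%:~R != 0 :> 'F_p.
  apply/eqP=> z0; apply: D0; apply/(eqz_modp_Fp _ _ p_pr).
  by rewrite rmorphD rmorphM !rmorphXn /= Dz z0 expr0n.
exists ((A%:~R + z%:~R) / 2), ((A%:~R - z%:~R) / 2); split.
- by field.
(* Multiplying by 4 clears the denominators: [A^2 - z^2 = -4B]. *)
- have four0 : 4 != 0 :> 'F_p by rewrite (natrM _ 2 2) mulf_neq0.
  apply: (mulfI four0).
  transitivity (A%:~R ^+ 2 - z%:~R ^+ 2 : 'F_p); first by field.
  by rewrite -Dz; ring.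
- rewrite -subr_eq0.
  by have -> : (A%:~R + z%:~R) / 2 - (A%:~R - z%:~R) / 2 = z%:~R :> 'F_p by field.
Qed.

Lemma Fp_fermat (p : nat) (x : 'F_p) : prime p -> x != 0 -> x ^+ (p - 1) = 1.
Proof.
move=> p_pr x0; apply: (mulfI x0); rewrite -exprS subn1 prednK ?prime_gt0 //.
by rewrite mulr1 -[RHS]expf_card card_Fp.
Qed.

Theorem theorem6 (p : nat) (A B : int)
    (p_prime : prime p) (p_odd : odd p)
    (Delta_qr : nonzero_quadratic_residue p (A ^+ 2 + 4 * B)) :
  (~~ (p%:Z %| B)%Z -> exists k : nat, is_period A B p k) /\
  (forall k : nat, is_period A B p k -> (k %| p - 1)%N /\ (k <= p - 1)%N).
Proof.
have [x [y [sxy pxy dxy]]] := Fp_roots p_prime p_odd Delta_qr.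
have retE i := return_index_roots i p_prime sxy pxy dxy.
have p1_gt0 : (0 < p - 1)%N by rewrite subn_gt0 prime_gt1.
split=> [pB | k [/retE [k0 xk yk] k_min]].
  (* Since [x y = -B], both roots are nonzero, so Fermat makes [p - 1] a return index and a least
     one exists. *)
  have xy0 : x * y != 0 by rewrite pxy oppr_eq0 -(dvdz_pcharf (pchar_Fp p_prime)).
  have [x0 y0] : x != 0 /\ y != 0 by apply/andP; rewrite -negb_or -mulf_eq0.
  pose P i := [&& (0 < i)%N, x ^+ i == 1 & y ^+ i == 1].
  have exP : exists i, P i by exists (p - 1)%N; rewrite /P p1_gt0 !Fp_fermat ?eqxx.
  case: (ex_minnP exP) => k /and3P[k0 /eqP xk /eqP yk] k_min.
  exists k; split; first exact/retE.
  by move=> i /retE[i0 xi yi]; apply: k_min; rewrite /P i0 xi yi !eqxx.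
(* Here the roots are nonzero because a positive power of each equals 1. *)
have unit_root (z : 'F_p) : z ^+ k = 1 -> z != 0.
  by apply: contra_eq_neq => ->; rewrite expr0n gtn_eqF // eq_sym oner_eq0.
suff k_dvd : (k %| p - 1)%N by split=> //; apply: dvdn_leq.
(* A positive remainder of [p - 1] modulo [k] would be a return index below [k]. *)
rewrite /dvdn -leqn0 leqNgt; apply/negP=> r0.
have /k_min : return_index A B p ((p - 1) %% k).
  apply/retE; split; rewrite ?expr_mod //;
  by apply: Fp_fermat => //; apply: unit_root.
by rewrite leqNgt ltn_mod k0.
Qed.
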